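(* Let $\mathcal{F}$ be a basis of $\mathbb{Q}_p^d$, let $A,B\in \mathrm{GL}_d(\mathbb{Q}_p)$, and let $\alpha:=A_v$, $\beta:=B_v$ be the vertices of the building $\mathscr{B}(\mathrm{SL}_d(\mathbb{Q}_p))$ represented by $A$ and $B$ with respect to $\mathcal{F}$. Then the graph distance $\delta(\alpha,\beta)$ of $\alpha$ and $\beta$ in the $1$-skeleton $\mathscr{B}^1$ of the building equals $$\delta(\alpha,\beta)=m_{A:0,B:d}+m_{A:d,B:0}-m_{A:1,B:d-1}-m_{A:d-1,B:1}.$$
   Context: Throughout, $p$ is a fixed prime and $d\ge 2$ a fixed integer. $\nu:\mathbb{Q}_p\to\mathbb{Z}\cup\{\infty\}$ is the $p$-adic valuation with $\nu(p)=1$, $\nu(0)=\infty$. For a square matrix $X$ over $\mathbb{Q}_p$, $|X|_p:=\nu(\det X)$. Building. A $\mathbb{Z}_p$-lattice in $\mathbb{Q}_p^d$ is a finitely generated $\mathbb{Z}_p$-submodule spanning $\mathbb{Q}_p^d$ over $\mathbb{Q}_p$. Lattices $\mathcal{L},\mathcal{L}'$ are homothetic if $\mathcal{L}'=a\mathcal{L}$ for some $a\in\mathbb{Q}_p^\times$. The building $\mathscr{B}=\mathscr{B}(\mathrm{SL}_d(\mathbb{Q}_p))$ is the abstract simplicial complex whose vertices are the homothety classes of $\mathbb{Z}_p$-lattices in $\mathbb{Q}_p^d$, and whose $k$-simplices are the sets $\{[\mathcal{L}_0],\dots,[\mathcal{L}_k]\}$ for chains of lattices $\mathcal{L}_0\supsetneq\mathcal{L}_1\supsetneq\cdots\supsetneq\mathcal{L}_k\supsetneq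 p\mathcal{L}_0$. $\mathscr{B}^1$ is its $1$-skeleton, viewed as a graph. Matrix representatives. Given a basis $\mathcal{F}=\{u_1,\dots,u_d\}$ of $\mathbb{Q}_p^d$ and $A\in\mathrm{GL}_d(\mathbb{Q}_p)$, $A_v=A_{v:\mathcal{F}}$ denotes the vertex given by the $\mathbb{Z}_p$-lattice spanned by the vectors $v_i=\sum_{j}A_{i,j}u_j$, $i=1,\dots,d$. The numbers $m$. For $A,B\in\mathrm{GL}_d(\mathbb{Q}_p)$ and $0\le i\le d$, $m_{A:i,B:d-i}$ is the minimum of $|X|_p$ over all $d\times d$ matrices $X$ composed of $i$ rows of $A$ (with distinct row indices) and $d-i$ rows of $B$ (with distinct row indices). *)

(* Defs.v *)
From HB Require Import structures.
From mathcomp Require Import all_boot all_order all_algebra.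
From mathcomp Require Import generic_quotient boolp classical_sets.
From mathcomp Require Import constructive_ereal.

Set Implicit Arguments.
Unset Strict Implicit.
Unset Printing Implicit Defensive.

Import Order.TTheory GRing.Theory Num.Theory.

Local Open Scope classical_set_scope.
Local Open Scope ring_scope.

(* Z_p as the inverse limit of the rings Z/p^n. The component [x n] is the
   representative in [0, p^n) of the residue class modulo p^n; the single
   condition below says both that it is reduced and that it is the image of
   [x n.+1]. *)
Record padic_int (p : nat) (p_pr : prime p) := PadicInt {
  residue :> nat -> int;
  residueE : forall n, residue n = (residue n.+1 %% p%:Z ^+ n)%Z }.

Section PadicInt.
Variables (p : nat) (p_pr : prime p).
Local Notation Z_p := (padic_int p_pr).
Implicit Types x y z : Z_p.

HB.instance Definition _ := gen_eqMixin Z_p.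
HB.instance Definition _ := gen_choiceMixin Z_p.

Lemma padic_intP x y : x =1 y -> x = y.
Proof.
case: x y => [x xE] [y yE] /= /funext eq_xy; case: _ / eq_xy in yE *.
by rewrite (Prop_irrelevance xE yE).
Qed.

Lemma modz_pexp (a : int) n :
  ((a %% p%:Z ^+ n.+1)%Z %% p%:Z ^+ n)%Z = (a %% p%:Z ^+ n)%Z.
Proof.
rewrite [in RHS](divz_eq a (p%:Z ^+ n.+1)).
by rewrite exprS mulrA modzMDl.
Qed.

Lemma residue_mod x n : (x n %% p%:Z ^+ n)%Z = x n.
Proof. by rewrite [in RHS]residueE [in LHS]residueE modz_mod. Qed.

Fact reduce_subproof (f : nat -> int) :
    (forall n, f n = f n.+1 %[mod p%:Z ^+ n])%Z ->
  forall n,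
    (f n %% p%:Z ^+ n)%Z = ((f n.+1 %% p%:Z ^+ n.+1)%Z %% p%:Z ^+ n)%Z.
Proof. by move=> fE n; rewrite modz_pexp fE. Qed.

Definition reduce f fE : Z_p := PadicInt p_pr (@reduce_subproof f fE).

Fact const_subproof (a : int) n : (a = a %[mod p%:Z ^+ n])%Z.
Proof. by []. Qed.

Fact add_subproof x y n : (x n + y n = x n.+1 + y n.+1 %[mod p%:Z ^+ n])%Z.
Proof. by rewrite (residueE x n) (residueE y n) modzDm. Qed.

Fact opp_subproof x n : (- x n = - x n.+1 %[mod p%:Z ^+ n])%Z.
Proof. by rewrite (residueE x n) modzNm. Qed.

Fact mul_subproof x y n : (x n * y n = x n.+1 * y n.+1 %[mod p%:Z ^+ n])%Z.
Proof. by rewrite (residueE x n) (residueE y n) modzMm. Qed.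

Definition padic_const (a : int) := reduce (const_subproof a).
Definition padic_add x y := reduce (add_subproof x y).
Definition padic_opp x := reduce (opp_subproof x).
Definition padic_mul x y := reduce (mul_subproof x y).

Fact padic_addA : associative padic_add.
Proof.
by move=> x y z; apply: padic_intP => n /=; rewrite modzDmr modzDml addrA.
Qed.

Fact padic_addC : commutative padic_add.
Proof. by move=> x y; apply: padic_intP => n /=; rewrite addrC. Qed.

Fact padic_add0 : left_id (padic_const 0) padic_add.
Proof.
by move=> x; apply: padic_intP => n /=; rewrite mod0z add0r residue_mod.
Qed.

Fact padic_addN : left_inverse (padic_const 0) padic_opp padic_add.
Proof. by move=> x; apply: padic_intP => n /=; rewrite modzDml addNr. Qed.

HB.instance Definition _ := GRing.isZmodule.Build Z_p
  padic_addA padic_addC padic_add0 padic_addN.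

Fact padic_mulA : associative padic_mul.
Proof.
by move=> x y z; apply: padic_intP => n /=; rewrite modzMmr modzMml mulrA.
Qed.

Fact padic_mulC : commutative padic_mul.
Proof. by move=> x y; apply: padic_intP => n /=; rewrite mulrC. Qed.

Fact padic_mul1 : left_id (padic_const 1) padic_mul.
Proof.
by move=> x; apply: padic_intP => n /=; rewrite modzMml mul1r residue_mod.
Qed.

Fact padic_mulDl : left_distributive padic_mul padic_add.
Proof.
by move=> x y z; apply: padic_intP => n /=; rewrite modzMml modzDm mulrDl.
Qed.

Fact padic_oner_neq0 : padic_const 1 != 0.
Proof.
apply/eqP => /(congr1 (fun x : Z_p => x 1)) /=.
by rewrite expr1 mod0z modz_small // ltz_nat prime_gt1.
Qed.

HB.instance Definition _ := GRing.Zmodule_isComNzRing.Build Z_p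
  padic_mulA padic_mulC padic_mul1 padic_mulDl padic_oner_neq0.

Definition padic_unit : {pred Z_p} := fun x => `[< exists y, y * x = 1 >].

Definition padic_inv x : Z_p :=
  if pselect (exists y, y * x = 1) is left ex then xget 0 [set y | y * x = 1]
  else x.

Fact padic_mulVr : {in padic_unit, left_inverse 1 padic_inv *%R}.
Proof.
move=> x /asboolP xU; rewrite /padic_inv; case: pselect => // _.
exact: (@xgetPex _ 0 [set y | y * x = 1] xU).
Qed.

Fact padic_unitP x y : y * x = 1 -> padic_unit x.
Proof. by move=> yx; apply/asboolP; exists y. Qed.

Fact padic_inv_out : {in [predC padic_unit], padic_inv =1 id}.
Proof.
move=> x; rewrite inE /= => xNU; rewrite /padic_inv; case: pselect => // ex.
by case/negP: xNU; apply/asboolP.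
Qed.

HB.instance Definition _ := GRing.ComNzRing_hasMulInverse.Build Z_p
  padic_mulVr padic_unitP padic_inv_out.

Lemma residue0 n : (0 : Z_p) n = 0.
Proof. by rewrite /= mod0z. Qed.

Lemma residueM x y n : (x * y) n = (x n * y n %% p%:Z ^+ n)%Z.
Proof. by []. Qed.

Lemma padic_neq0 x : x != 0 -> exists n, x n != 0.
Proof.
move=> x0; apply/not_existsP => xn; move/eqP: x0; apply.
by apply: padic_intP => n; rewrite residue0; apply/eqP/negP => /negP /xn.
Qed.

Lemma residue_dvd x n m : (n <= m)%N -> (p%:Z ^+ n %| x m - x n)%Z.
Proof.
elim: m => [|m IHm]; first by rewrite leqn0 => /eqP ->; rewrite subrr dvdz0.
rewrite leq_eqVlt => /orP[/eqP ->|]; first by rewrite subrr dvdz0.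
rewrite ltnS => le_nm; rewrite -(subrKA (x m)) rpredD ?IHm //.
apply: (@dvdz_trans (p%:Z ^+ m)); first by rewrite dvdz_exp2l.
by rewrite -eqz_mod_dvd residue_mod [X in _ == X]residueE.
Qed.

Lemma residue_eq0 x n m : (n <= m)%N -> (p%:Z ^+ n %| x m)%Z = (x n == 0).
Proof.
move=> le_nm; rewrite -[x m](subrK (x n)) rpredDl ?residue_dvd //.
by apply/idP/eqP => [/dvdz_mod0P|->]; rewrite ?residue_mod ?dvdz0.
Qed.

Fact padic_integral x y : x * y = 0 -> (x == 0) || (y == 0).
Proof.
move=> xy0; apply/norP => -[/padic_neq0[a xa] /padic_neq0[b yb]].
have: (x * y) (a + b)%N == 0 by rewrite xy0 residue0.
rewrite -(residue_eq0 _ (leqnn _)) residueM.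
move/dvdz_mod0P; rewrite modz_mod => /dvdz_mod0P.
move: xa yb; rewrite -(residue_eq0 x (leq_addr b a)).
rewrite -(residue_eq0 y (leq_addl a b)).
rewrite !dvdzE !abszX abszM /=.
move: `|x _|%N `|y _|%N => u v.
have [->|u0] := posnP u; first by rewrite dvdn0.
have [->|v0] := posnP v; first by rewrite dvdn0.
rewrite !pfactor_dvdn ?muln_gt0 ?u0 // lognM // -!ltnNge => ua vb.
by apply/negP; rewrite -ltnNge -addSn leq_add // ltnW.
Qed.

HB.instance Definition _ :=
  GRing.ComUnitRing_isIntegral.Build Z_p padic_integral.

(* The valuation of a nonzero x is the least n such that p^(n+1) does not
   divide x. *)
Definition padic_int_val x : \bar int :=
  match pselect (exists n, x n.+1 != 0) with
  | left ex => (ex_minn ex)%:Z%:E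
  | right _ => +oo%E
  end.

End PadicInt.

Notation padic p_pr := {fraction padic_int p_pr}.

Definition val_p (p : nat) (p_pr : prime p) (x : padic p_pr) : \bar int :=
  (padic_int_val \n_(repr x) - padic_int_val \d_(repr x))%E.

Section Building.
Variables (p : nat) (p_pr : prime p) (d : nat).
Local Notation Z_p := (padic_int p_pr).
Local Notation Q_p := (padic p_pr).
Local Notation V := 'rV[Q_p]_d.

Definition Zp_span (s : seq V) : set V :=
  [set v | exists c : 'I_(size s) -> Z_p,
             v = \sum_(i < size s) FracField.tofrac (c i) *: s`_i].

Definition lattice (L : set V) : Prop :=
  (exists s, L = Zp_span s) /\
  (forall v, exists2 t : seq V, {in t, forall w, L w} & v \in <<t>>%VS).

Definition scale_set (a : Q_p) (L : set V) : set V := [set a *: v | v in L].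

Definition homothetic (L L' : set V) : Prop :=
  exists2 a : Q_p, a != 0 & L' = scale_set a L.

Definition homothety_class (L : set V) : set (set V) :=
  [set L' | lattice L' /\ homothetic L L'].

(* The simplicial complex is given by its simplices; the vertices are the
   classes [homothety_class L] with [lattice L] (the case k = 0). *)
Definition simplex (k : nat) (S : set (set (set V))) : Prop :=
  exists L : nat -> set V,
    [/\ forall i, (i <= k)%N -> lattice (L i),
        forall i, (i < k)%N -> L i.+1 `<` L i,
        scale_set p%:R (L 0) `<` L k
      & S = [set homothety_class (L i) | i in [set i | (i <= k)%N]]].

Definition skeleton1 : rel (set (set V)) :=
  fun x y => `[< simplex 1 [set x; y] >].

Definition represented_vertex (u : d.-tuple V) (A : 'M[Q_p]_d) : set (set V) :=
  homothety_class
    (Zp_span [seq \sum_(j < d) A i j *: tnth u j | i <- enum 'I_d]).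

End Building.

Definition graph_dist (T : Type) (e : rel T) (x y : T) : \bar int :=
  let walk n := `[< exists s : seq T, [/\ size s = n, path e x s & last x s = y] >] in
  match pselect (exists n, walk n) with
  | left ex => (ex_minn ex)%:Z%:E
  | right _ => +oo%E
  end.

(* A matrix composed of rows of A and of B is encoded by the choice, for each
   row index, of a row of A ([inl]) or of B ([inr]). *)
Definition compose_rows (R : Type) (d : nat) (A B : 'M[R]_d)
    (s : {ffun 'I_d -> 'I_d + 'I_d}) : 'M[R]_d :=
  \matrix_(k, l) match s k with inl i => A i l | inr i => B i l end.

(* Injectivity of [s] says that the row indices taken from each of the two
   matrices are distinct. *)
Definition min_val (p : nat) (p_pr : prime p) (d : nat)
    (A : 'M[padic p_pr]_d) (i : nat) (B : 'M[padic p_pr]_d) (j : nat) : \bar int :=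
  \big[Order.min/+oo%E]_(s : {ffun 'I_d -> 'I_d + 'I_d} |
      [&& injectiveb s, #|[pred k | is_inl (s k)]| == i
                      & #|[pred k | ~~ is_inl (s k)]| == j])
    val_p (\det (compose_rows A B s)).

(* Main.v *)
Require Import Defs.
From HB Require Import structures.
From mathcomp Require Import all_boot all_order all_algebra all_fingroup.
From mathcomp Require Import generic_quotient.
From mathcomp Require Import boolp classical_sets constructive_ereal.
From mathcomp Require Import zify.

Set Implicit Arguments.
Unset Strict Implicit.
Unset Printing Implicit Defensive.

Import Order.TTheory GRing.Theory Num.Theory.

Local Open Scope ring_scope.

(** Two vertices are at distance at most n in the 1-skeleton exactly when they
have representatives L and M with p^n L <= M <= L. A chain of n edges gives
such a pair by composing the inclusions of its steps, since each edge joins L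
to the class of some N with p L <= N <= L ([sub_of_path]). Conversely, given
p^n L <= M <= L, the lattice N = M + p L satisfies p L <= N <= L and
p^(n-1) N <= M <= N, so that induction on n gives a path of length at most n
([path_of_sub]).

Let L and M be the lattices represented by A and B. An inclusion a L <= b M
means that the matrix (a / b) A B^-1 has p-adic integer entries
([row_lattice_sub]). Let m and m' be the least valuations of the entries of
A B^-1 and of B A^-1. Then a M <= L and p^n L <= a M hold for some a if and only
if n >= - m - m', the best a having valuation - m'. The distance is therefore
- m - m', which is nonnegative because the two matrices are inverse to each
other.

Finally, replacing one row of B by the row i of A multiplies det B by an entry
of the row i of A B^-1, by Cramer's rule, and every entry of A B^-1 arises in
this way. So m_{A:1,B:d-1} = v(det B) + m ([min_val1]), and symmetrically
m_{A:d-1,B:1} = v(det A) + m', while m_{A:0,B:d} = v(det B) and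
m_{A:d,B:0} = v(det A). The determinants cancel and leave - m - m'.

The valuation is handled through the decomposition of every nonzero p-adic
number as the quotient of two elements p^n u with u a unit of Z_p; it yields
that the valuation is additive and that it is nonnegative exactly on Z_p
([val_pM], [val_p_ge0]). *)

(** * Factorization of p-adic integers *)

Section PadicInteger.
Variables (p : nat) (p_pr : prime p).
Local Notation Z_p := (padic_int p_pr).
Implicit Types x y u v : Z_p.

Lemma residue_at0 x : x 0%N = 0.
Proof. by rewrite residueE expr0 modz1. Qed.

Lemma residue_natr k n : (k%:R : Z_p) n = (k%:Z %% p%:Z ^+ n)%Z.
Proof.
elim: k => [|k IHk]; first by rewrite residue0 mod0z.
rewrite mulrS.
have -> : (1 + k%:R : Z_p) n = (((1 : Z_p) n + (k%:R : Z_p) n) %% p%:Z ^+ n)%Z.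
  by [].
by rewrite IHk /= modzDm -intS.
Qed.

Lemma residue_pexp n k : (p%:R ^+ n : Z_p) k = (p%:Z ^+ n %% p%:Z ^+ k)%Z.
Proof. by rewrite -natrX residue_natr -natz natrX natz. Qed.

Lemma unit_residue1_neq0 x : x \is a GRing.unit -> x 1%N != 0.
Proof.
move=> xU; apply/eqP => x1.
have /(congr1 (fun z : Z_p => z 1%N)) := divrr xU.
rewrite residueM x1 mul0r mod0z /= expr1 modz_small //.
by rewrite ltz_nat prime_gt1.
Qed.

(** The inverse is assembled from inverses of the residues modulo each p^n,
which are coherent because inverses modulo p^n are unique. *)
Lemma residue1_neq0_unit x : x 1%N != 0 -> x \is a GRing.unit.
Proof.
move=> x1.
have cop n : coprimez (x n) (p%:Z ^+ n).
  case: n => [|n]; first by rewrite expr0 coprimezE coprimen1.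
  apply: coprimezXr; rewrite coprimez_sym coprimezE prime_coprime //.
  by rewrite -dvdzE -[p%:Z]expr1 residue_eq0.
have inv n : exists y : int, (y * x n = 1 %[mod p%:Z ^+ n])%Z.
  have /coprimezP[[a b] /= ab1] := cop n.
  exists a; apply/eqP; rewrite eqz_mod_dvd -ab1 opprD addrA subrr sub0r.
  by rewrite dvdzE abszN -dvdzE dvdz_mull.
have [y yP] := choice inv.
have yE n : (y n = y n.+1 %[mod p%:Z ^+ n])%Z.
  have y1 : (y n.+1 * x n = 1 %[mod p%:Z ^+ n])%Z.
    have := congr1 (fun z => (z %% p%:Z ^+ n)%Z) (yP n.+1).
    by rewrite !modz_pexp (residueE x n) modzMmr.
  by rewrite -[y n]mul1r -modzMml -y1 modzMml mulrAC -mulrA -modzMmr yP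
    modzMmr mulr1.
apply/unitrP; exists (reduce p_pr yE).
suff yx1 : reduce p_pr yE * x = 1 by rewrite [x * _]mulrC yx1.
by apply: padic_intP => n; rewrite residueM /= modzMml yP.
Qed.

(** The element p^n u vanishes modulo p^k exactly when k <= n: its valuation
is n. *)
Lemma residue_pexpM n u k :
  u \is a GRing.unit -> ((p%:R ^+ n * u) k == 0) = (k <= n)%N.
Proof.
move/unit_residue1_neq0 => u1.
rewrite residueM residue_pexp modzMml.
rewrite -(sameP dvdz_mod0P eqP).
have [le_kn|lt_nk] := leqP k n; first by rewrite dvdz_mulr // dvdz_exp2l.
have p0 : p%:Z ^+ n != 0 by rewrite expf_neq0 // eqz_nat -lt0n prime_gt0.
rewrite -(subnK lt_nk) addnS -addSn addnC exprD dvdz_mul2l // exprS.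
apply/negP => /(dvdz_trans (dvdz_mulr _ (dvdzz _))).
rewrite -[X in (X %| _)%Z]expr1 residue_eq0 ?(negPf u1) //.
by rewrite addnS ltnS leq0n.
Qed.

Lemma padic_int_decomp x :
  x != 0 -> exists n u, u \is a GRing.unit /\ x = p%:R ^+ n * u.
Proof.
move=> /padic_neq0 x_neq0.
have ex1 : exists n, x n.+1 != 0.
  by case: x_neq0 => -[|n]; [rewrite residue_at0 eqxx | exists n].
case: (ex_minnP ex1) => n xn n_min.
have xn0 : x n = 0.
  case: n n_min {xn} => [|n] n_min; first exact: residue_at0.
  by apply/eqP; apply: contraT => /n_min; rewrite ltnn.
have p0 m : p%:Z ^+ m != 0 by rewrite expf_neq0 // eqz_nat -lt0n prime_gt0.
have pdvd m : (p%:Z ^+ n %| x (m + n)%N)%Z.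
  by rewrite residue_eq0 ?xn0 // leq_addl.
(* The cofactor u of p^n has residue x (m + n) / p^n modulo p^m. *)
pose y m := (x (m + n)%N %/ p%:Z ^+ n)%Z.
have yE m : (y m = y m.+1 %[mod p%:Z ^+ m])%Z.
  apply/eqP; rewrite eqz_mod_dvd -(dvdz_mul2r (p0 n)) mulrBl !divzK //.
  by rewrite -exprD -eqz_mod_dvd residue_mod addSn -residueE.
exists n, (reduce p_pr yE); split.
  apply: residue1_neq0_unit; apply: contraNneq xn => /= y1.
  rewrite -(residue_eq0 x (leqnn _)) -add1n -(divzK (pdvd 1%N)).
  by rewrite exprD dvdz_mul2r //; apply/dvdz_mod0P.
apply: padic_intP => m; rewrite residueM residue_pexp /=.
rewrite modzMm [_ * y m]mulrC divzK // -[LHS]residue_mod; apply/eqP.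
by rewrite eq_sym eqz_mod_dvd residue_dvd // leq_addr.
Qed.

Lemma padic_int_val0 : padic_int_val (0 : Z_p) = +oo%E.
Proof.
rewrite /padic_int_val; case: pselect => // -[n x0]; exfalso.
by move: x0; rewrite residue0 eqxx.
Qed.

Lemma padic_int_valE n u :
  u \is a GRing.unit -> padic_int_val (p%:R ^+ n * u) = n%:Z%:E.
Proof.
move=> uU; rewrite /padic_int_val; case: pselect => [ex|[]]; last first.
  by exists n; rewrite residue_pexpM // ltnn.
case: ex_minnP => m; rewrite residue_pexpM // -leqNgt => le_nm m_min.
congr (_%:Z%:E); apply/eqP; rewrite eqn_leq le_nm andbT m_min //.
by rewrite residue_pexpM // ltnn.
Qed.

Lemma pexp_inj m n u v :
    u \is a GRing.unit -> v \is a GRing.unit ->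
  p%:R ^+ m * u = p%:R ^+ n * v -> m = n.
Proof.
move=> uU vU /(congr1 (@padic_int_val _ _)).
by rewrite !padic_int_valE //; case.
Qed.

End PadicInteger.

(** * The valuation on p-adic numbers *)

Section PadicNumber.
Variables (p : nat) (p_pr : prime p).
Local Notation Z_p := (padic_int p_pr).
Local Notation Q_p := (padic p_pr).
Local Notation "x %:F" := (@FracField.tofrac Z_p x).
Implicit Types (u v : Z_p) (q r : Q_p).

(** A p-adic number is the quotient of the numerator and denominator of the
representative that defines its valuation. *)
Lemma padic_frac q : q = (\n_(repr q))%:F / (\d_(repr q))%:F.
Proof.
have d0 : (\d_(repr q))%:F != 0 by rewrite tofrac_eq0 denom_ratioP.
apply: (mulIf d0); rewrite divfK // -{1}[q]reprK.
move: (repr q) d0 => x _.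
rewrite /FracField.tofrac; unlock; rewrite -[LHS]FracField.pi_mul.
apply/eqmodP; rewrite /= FracField.equivfE /FracField.mulf.
by rewrite !numden_Ratio ?mulf_neq0 ?oner_neq0 ?denom_ratioP // !mulr1 mulrC.
Qed.

Lemma padic_p_neq0 : (p%:R : Q_p) != 0.
Proof.
rewrite -(rmorph_nat (@FracField.tofrac Z_p)) tofrac_eq0.
apply/eqP => /(congr1 (fun z : Z_p => z 2)); rewrite residue_natr residue0.
rewrite modz_small; first by move/eqP; rewrite eqz_nat eqn0Ngt prime_gt0.
by rewrite le0z_nat /= expr2 -PoszM ltz_nat ltn_Pmull ?prime_gt1 ?prime_gt0.
Qed.

Lemma frac_pexp_neq0 n u : u \is a GRing.unit -> (p%:R ^+ n * u)%:F != 0.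
Proof.
move=> uU; rewrite rmorphM rmorphXn rmorph_nat; apply: mulf_neq0.
  exact/expf_neq0/padic_p_neq0.
by rewrite tofrac_eq0; apply: contraTneq uU => ->; rewrite unitr0.
Qed.

Lemma val_p_frac (a b : nat) u v :
    u \is a GRing.unit -> v \is a GRing.unit ->
  val_p ((p%:R ^+ a * u)%:F / (p%:R ^+ b * v)%:F) = (a%:Z - b%:Z)%:E.
Proof.
move=> uU vU; set q := (_ / _).
have q0 : q != 0 by rewrite mulf_neq0 ?invr_neq0 ?frac_pexp_neq0.
rewrite /val_p.
have d0 := denom_ratioP (repr q).
have n0 : \n_(repr q) != 0.
  by apply: contraNneq q0 => n0; rewrite [q]padic_frac n0 tofrac0 mul0r.
have := padic_frac q.
move: (\n_ _) (\d_ _) n0 d0 => n d n0 d0.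
have [a' [u' [uU' ->]]] := padic_int_decomp n0.
have [b' [v' [vU' ->]]] := padic_int_decomp d0.
rewrite !padic_int_valE // -EFinB.
move/eqP; rewrite eqr_div ?frac_pexp_neq0 // -!rmorphM tofrac_eq mulrACA -exprD.
rewrite [X in _ == X]mulrACA -exprD => /eqP.
move/pexp_inj; rewrite !unitrM => /(_ (introT andP (conj uU vU'))).
by move/(_ (introT andP (conj uU' vU))) => E; congr (_%:E); lia.
Qed.

Lemma padic_decomp q : q != 0 -> exists a b u v,
  [/\ u \is a GRing.unit, v \is a GRing.unit
    & q = (p%:R ^+ a * u)%:F / (p%:R ^+ b * v)%:F].
Proof.
rewrite [q]padic_frac mulf_eq0 invr_eq0 negb_or !tofrac_eq0 => /andP[n0 d0].
have [a [u [uU ->]]] := padic_int_decomp n0.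
have [b [v [vU ->]]] := padic_int_decomp d0.
by exists a, b, u, v.
Qed.

Lemma val_p0 : val_p (0 : Q_p) = +oo%E.
Proof.
have := padic_frac (0 : Q_p); rewrite /val_p.
have := denom_ratioP (repr (0 : Q_p)).
move: (\n_ _) (\d_ _) => n d d0 /esym/eqP.
rewrite mulf_eq0 invr_eq0 !tofrac_eq0 (negPf d0) orbF => /eqP ->.
have [b [v [vU ->]]] := padic_int_decomp d0.
by rewrite padic_int_val0 padic_int_valE.
Qed.

Lemma val_p_fin q : q != 0 -> exists k : int, val_p q = k%:E.
Proof.
move/padic_decomp => [a [b [u [v [uU vU ->]]]]].
by exists (a%:Z - b%:Z); rewrite val_p_frac.
Qed.

Lemma val_pM q r : val_p (q * r) = (val_p q + val_p r)%E.
Proof.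
have [->|q0] := eqVneq q 0.
  rewrite mul0r val_p0; have [->|r0] := eqVneq r 0; first by rewrite val_p0.
  by have [k ->] := val_p_fin r0.
have [->|r0] := eqVneq r 0.
  by rewrite mulr0 val_p0; have [k ->] := val_p_fin q0.
have [a [b [u [v [uU vU ->]]]]] := padic_decomp q0.
have [a' [b' [u' [v' [uU' vU' ->]]]]] := padic_decomp r0.
rewrite mulf_div -!rmorphM mulrACA -exprD [X in _ / X%:F]mulrACA -exprD.
rewrite !val_p_frac ?unitrM ?uU ?vU //; congr (_%:E); lia.
Qed.

Lemma val_p1 : val_p (1 : Q_p) = 0%E.
Proof.
have := @val_p_frac 0 0 1 1 (unitr1 _) (unitr1 _).
by rewrite expr0 mulr1 tofrac1 divr1.
Qed.

Lemma val_pN q : val_p (- q) = val_p q.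
Proof.
have NU : (-1 : Z_p) \is a GRing.unit by rewrite unitrN1.
have := @val_p_frac 0 0 (-1) 1 NU (unitr1 _).
rewrite expr0 !mul1r tofrac1 divr1 tofracN tofrac1 subrr => N1.
by rewrite -mulN1r val_pM N1 add0e.
Qed.

Lemma val_p_p : val_p (p%:R : Q_p) = 1%:E.
Proof.
have := @val_p_frac 1 0 1 1 (unitr1 _) (unitr1 _).
by rewrite expr0 expr1 !mulr1 tofrac1 divr1 rmorph_nat subr0.
Qed.

Lemma val_p_pexp (n : nat) : val_p (p%:R ^+ n : Q_p) = n%:Z%:E.
Proof.
elim: n => [|n IHn]; first by rewrite expr0 val_p1.
by rewrite exprS val_pM IHn val_p_p -EFinD -intS.
Qed.

Lemma val_pV q : q != 0 -> val_p q^-1 = (- val_p q)%E.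
Proof.
move=> q0; have := val_pM q q^-1; rewrite mulfV // val_p1.
have [a ->] := val_p_fin q0; have [|b ->] := @val_p_fin (q^-1).
  by rewrite invr_neq0.
by rewrite -EFinD => -[/esym/eqP]; rewrite addrC addr_eq0 => /eqP ->.
Qed.

Lemma val_p_expz (k : int) : val_p (p%:R ^ k : Q_p) = k%:E.
Proof.
case: k => n; first exact: val_p_pexp.
rewrite NegzE -exprnN val_pV ?expf_neq0 ?padic_p_neq0 // val_p_pexp.
by rewrite EFinN.
Qed.

(** The subring Z_p of Q_p, as a predicate on Q_p. *)
Definition integral : pred Q_p := fun q => `[< exists x : Z_p, q = x%:F >].

Lemma integralP q : reflect (exists x : Z_p, q = x%:F) (q \in integral).
Proof. exact: asboolP. Qed.

Lemma integral_subring : subring_closed integral.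
Proof.
split; first by apply/integralP; exists 1; rewrite tofrac1.
  move=> _ _ /integralP[x ->] /integralP[y ->].
  by apply/integralP; exists (x - y); rewrite tofracB.
move=> _ _ /integralP[x ->] /integralP[y ->].
by apply/integralP; exists (x * y); rewrite tofracM.
Qed.

HB.instance Definition _ :=
  GRing.isSubringClosed.Build Q_p integral integral_subring.

Lemma integral_tofrac (x : Z_p) : x%:F \in integral.
Proof. by apply/integralP; exists x. Qed.

Lemma val_p_ge0 q : (0 <= val_p q)%E = (q \in integral).
Proof.
have [->|q0] := eqVneq q 0; first by rewrite val_p0 rpred0 leey.
apply/idP/integralP => [|[x qx]].
  have [a [b [u [v [uU vU ->]]]]] := padic_decomp q0.
  rewrite val_p_frac // lee_fin subr_ge0 lez_nat => le_ba.
  exists (p%:R ^+ (a - b) * (u * v^-1)).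
  have v0 := frac_pexp_neq0 b vU.
  apply: (mulIf v0); rewrite (divfK v0) -rmorphM mulrACA -exprD subnK //.
  by rewrite mulrVK.
move: q0; rewrite {}qx tofrac_eq0 => /padic_int_decomp[n [u [uU ->]]].
have := @val_p_frac n 0 u 1 uU (unitr1 _).
by rewrite expr0 mulr1 tofrac1 divr1 subr0 => ->; rewrite lee_fin.
Qed.

End PadicNumber.

(** * Determinants of matrices composed of rows of A and B *)

(** Cramer's rule, for a matrix Y that agrees with X outside the row k0. *)
Lemma det_replace_row (K : fieldType) (d : nat) (X Y : 'M[K]_d) (k0 : 'I_d) :
    X \in unitmx -> (forall k l, k != k0 -> Y k l = X k l) ->
  \det Y = \det X * (Y *m invmx X) k0 k0.
Proof.
move=> XU YX; rewrite (expand_det_row Y k0) mxE /invmx XU mulr_sumr.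
apply: eq_bigr => l _; rewrite !mxE [RHS]mulrCA mulVKr -?unitmxE //.
congr (_ * (_ * \det _)); apply/matrixP => i j; rewrite !mxE YX //.
by rewrite eq_sym neq_lift.
Qed.

Lemma invmx_row_perm (K : fieldType) (d : nat) (sigma : 'S_d) (X : 'M[K]_d) :
  X \in unitmx -> invmx (row_perm sigma X) = invmx X *m perm_mx sigma^-1.
Proof.
move=> XU; have YU : row_perm sigma X \in unitmx.
  by rewrite row_permE unitmx_mul unitmx_perm.
apply: (can_inj (mulKmx YU)); rewrite mulmxV // row_permE mulmxA mulmxK //.
by rewrite -perm_mxM mulgV perm_mx1.
Qed.

Lemma val_p_det_row_perm (p : nat) (p_pr : prime p) (d : nat)
    (sigma : 'S_d) (B : 'M[padic p_pr]_d) :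
  val_p (\det (row_perm sigma B)) = val_p (\det B).
Proof.
rewrite row_permE det_mulmx det_perm; case: (odd_perm _).
  by rewrite expr1 mulN1r val_pN.
by rewrite expr0 mul1r.
Qed.

Section MinVal.
Variables (p : nat) (p_pr : prime p) (d : nat).
Local Notation Q_p := (padic p_pr).
Implicit Types (A B : 'M[Q_p]_d) (s : {ffun 'I_d -> 'I_d + 'I_d}).

(** The same choice of rows with the roles of the two matrices exchanged. *)
Definition swap_rows s : {ffun 'I_d -> 'I_d + 'I_d} :=
  [ffun k => match s k with inl i => inr i | inr i => inl i end].

Lemma compose_rows_swap A B s :
  compose_rows B A (swap_rows s) = compose_rows A B s.
Proof. by apply/matrixP => k l; rewrite !mxE ffunE; case: (s k). Qed.

Lemma min_val_swap_le A i B j : (min_val B j A i <= min_val A i B j)%O.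
Proof.
apply: le_bigmin; first exact: leey.
move=> s /and3P[/injectiveP s_inj iP jP].
rewrite -compose_rows_swap; apply: bigmin_le_cond.
apply/and3P; split.
- apply/injectiveP => k l; rewrite !ffunE => skl; apply: s_inj.
  by case: (s k) (s l) skl => [a|a] [b|b] // [->].
- rewrite -(eqP jP); apply/eqP/eq_card => k.
  by rewrite !inE ffunE; case: (s k).
- rewrite -(eqP iP); apply/eqP/eq_card => k.
  by rewrite !inE ffunE; case: (s k).
Qed.

Lemma min_valC A i B j : min_val A i B j = min_val B j A i.
Proof. by apply/le_anti/andP; split; apply: min_val_swap_le. Qed.

Lemma min_val0 A B : min_val A 0 B d = val_p (\det B).
Proof.
apply/le_anti/andP; split.
  pose s : {ffun 'I_d -> 'I_d + 'I_d} := [ffun k => inr k].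
  have -> : \det B = \det (compose_rows A B s).
    by congr (\det _); apply/matrixP => k l; rewrite mxE ffunE.
  apply: bigmin_le_cond; apply/and3P; split.
  - by apply/injectiveP => k l; rewrite !ffunE => -[].
  - by rewrite eq_card0 // => k; rewrite !inE ffunE.
  - by rewrite eq_cardT ?cardE ?size_enum_ord // => k; rewrite !inE ffunE.
apply: le_bigmin; first exact: leey.
move=> s /and3P[/injectiveP s_inj /eqP/card0_eq s_inr _].
pose f k := match s k with inr j => j | inl j => j end.
have sE k : s k = inr (f k).
  by have := s_inr k; rewrite !inE /f; case: (s k).
have f_inj : injective f.
  by move=> k l fkl; apply: s_inj; rewrite !sE fkl.
rewrite -(val_p_det_row_perm (perm f_inj)).
suff -> : row_perm (perm f_inj) B = compose_rows A B s by [].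
by apply/matrixP => k l; rewrite !mxE sE permE.
Qed.

(** With one row from A and the others from B, the determinant is, up to sign,
an entry of A B^-1 times det B. The row of B that is left out determines the
column of that entry. *)
Lemma det_compose_rows1 A B s : B \in unitmx ->
    injective s -> #|[pred k | is_inl (s k)]| = 1%N ->
  exists i j, val_p (\det (compose_rows A B s))
              = (val_p (\det B) + val_p ((A *m invmx B) i j))%E.
Proof.
move=> BU s_inj /mem_card1[k0 s_inl].
have [i si] : exists i, s k0 = inl i.
  by have := s_inl k0; rewrite !inE eqxx; case: (s k0) => // i; exists i.
pose f k := match s k with inr j => j | inl j => j end.
have sE k : k != k0 -> s k = inr (f k).
  by have := s_inl k; rewrite !inE /f; case: (s k) => //= j <-.
have f_inj : {in [set~ k0] &, injective f}.
  move=> k l; rewrite !inE => k0k k0l fkl.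
  by apply: s_inj; rewrite !sE // fkl.
have [j jP] : exists j, j \notin f @: [set~ k0].
  apply/existsP; rewrite -negb_forall; apply/negP => /forallP f_all.
  have : #|[set: 'I_d]| = #|f @: [set~ k0]|.
    by apply: eq_card => l; rewrite inE f_all.
  rewrite card_in_imset // cardsC1 cardsT card_ord.
  by have := ltn_ord k0; lia.
(* Completing f by the missing row j of B at k0 gives a permutation, so that the
   composed matrix is a row permutation of B with one row replaced. *)
pose g k := if k == k0 then j else f k.
have g_inj : injective g.
  move=> k l; rewrite /g.
  case: eqVneq => [->|k0k]; case: eqVneq => [->|k0l] // E.
  - by case/negP: jP; rewrite E imset_f // !inE.
  - by case/negP: jP; rewrite -E imset_f // !inE.
  - by apply: f_inj; rewrite ?inE.
exists i, j.
set sigma := perm g_inj.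
have XU : row_perm sigma B \in unitmx.
  by rewrite row_permE unitmx_mul unitmx_perm.
rewrite (@det_replace_row _ _ (row_perm sigma B) _ k0) //; last first.
  by move=> k l k0k; rewrite !mxE sE // permE /g (negPf k0k).
rewrite val_pM val_p_det_row_perm; congr (_ + val_p _)%E.
rewrite (invmx_row_perm _ BU).
rewrite mulmxA -col_permE mxE permE /g eqxx !mxE.
by apply: eq_bigr => l _; rewrite mxE si.
Qed.

Lemma min_val1 A B (m : int) : B \in unitmx ->
    (forall i j, (m%:E <= val_p ((A *m invmx B) i j))%E) ->
    (exists i j, val_p ((A *m invmx B) i j) = m%:E) ->
  min_val A 1 B d.-1 = (val_p (\det B) + m%:E)%E.
Proof.
move=> BU m_le [i [j mE]].
apply/le_anti/andP; split; last first.
  apply: le_bigmin; first exact: leey.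
  move=> s /and3P[/injectiveP s_inj /eqP s1 _].
  have [k [l ->]] := det_compose_rows1 A BU s_inj s1.
  by apply: leeD.
pose s : {ffun 'I_d -> 'I_d + 'I_d} :=
  [ffun k => if k == j then inl i else inr k].
have s1 : [pred k | is_inl (s k)] =i pred1 j.
  by move=> k; rewrite !inE ffunE; case: eqP.
have -> : (val_p (\det B) + m%:E)%E = val_p (\det (compose_rows A B s)).
  rewrite (@det_replace_row _ _ B (compose_rows A B s) j) //; last first.
    by move=> k l kj; rewrite !mxE ffunE (negPf kj).
  rewrite val_pM -mE; congr (_ + val_p _)%E.
  rewrite !mxE; apply: eq_bigr => l _; congr (_ * _).
  by rewrite mxE ffunE eqxx.
apply: bigmin_le_cond; apply/and3P; split.
- apply/injectiveP => k l; rewrite !ffunE.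
  by case: eqP => [->|_]; case: eqP => [->|_] // -[].
- by rewrite (eq_card s1) card1.
- apply/eqP; have := cardC [pred k | is_inl (s k)].
  rewrite (eq_card s1) card1 [in RHS]card_ord => /(congr1 predn) <- /=.
  by apply: eq_card => k; rewrite !inE.
Qed.

End MinVal.

(** * Lattices, homothety classes and paths in the 1-skeleton *)

Section Lattices.
Variables (p : nat) (p_pr : prime p) (d : nat).
Local Notation Z_p := (padic_int p_pr).
Local Notation Q_p := (padic p_pr).
Local Notation V := 'rV[Q_p]_d.
Local Notation "x %:F" := (@FracField.tofrac Z_p x).
Local Open Scope classical_set_scope.
Implicit Types (L M : set V) (a b : Q_p) (s t : seq V).

(** The coefficients may be indexed by all natural numbers, which frees their
type from the length of s. *)
Lemma Zp_span_nat s (v : V) :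
  Zp_span s v <->
  exists c : nat -> Z_p, v = \sum_(0 <= i < size s) (c i)%:F *: s`_i.
Proof.
split=> [[c ->]|[c ->]]; last first.
  by exists (fun i => c i); rewrite big_mkord.
exists (fun k => if insub k is Some i then c i else 0).
by rewrite big_mkord; apply: eq_bigr => i _; rewrite valK.
Qed.

Lemma Zp_span_nil : Zp_span [::] = [set (0 : V)].
Proof.
apply/seteqP; split=> [v [c ->]|v ->] /=; first by rewrite big_ord0.
by exists (fun=> 0); rewrite big_ord0.
Qed.

Lemma Zp_span_cons (u : V) s (v : V) :
  Zp_span (u :: s) v <-> exists2 c : Z_p, True & Zp_span s (v - c%:F *: u).
Proof.
split=> [/Zp_span_nat[c ->]|[c _ /Zp_span_nat[e vE]]].
  exists (c 0%N) => //; apply/Zp_span_nat; exists (fun i => c i.+1).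
  by rewrite big_nat_recl //= addrAC subrr add0r.
apply/Zp_span_nat; exists (fun i => if i is k.+1 then e k else c).
by rewrite big_nat_recl //= -vE addrC subrK.
Qed.

Lemma Zp_span0 s : Zp_span s (0 : V).
Proof.
apply/Zp_span_nat; exists (fun=> 0); rewrite big1 // => i _.
by rewrite tofrac0 scale0r.
Qed.

Lemma Zp_spanD s (v w : V) : Zp_span s v -> Zp_span s w -> Zp_span s (v + w).
Proof.
move=> [c ->] [e ->]; exists (fun i => c i + e i); rewrite -big_split.
by apply: eq_bigr => i _; rewrite tofracD scalerDl.
Qed.

Lemma Zp_spanZ s (a : Q_p) (v : V) :
  a \in @integral p p_pr -> Zp_span s v -> Zp_span s (a *: v).
Proof.
move=> /integralP[x ->] [c ->]; exists (fun i => x * c i).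
rewrite scaler_sumr; apply: eq_bigr => i _.
by rewrite tofracM scalerA.
Qed.

(** The sum of L and M; v is a sum when its difference with some element of L
lies in M. *)
Definition add_set L M : set V := [set v | exists2 w, L w & M (v - w)].

Lemma Zp_span_cat s t : Zp_span (s ++ t) = add_set (Zp_span s) (Zp_span t).
Proof.
apply/seteqP; split; elim: s => [|u s IHs] v /=.
- by move=> tv; exists 0; rewrite ?subr0 // Zp_span_nil.
- case/Zp_span_cons=> c _ /IHs[w sw tvw]; exists (c%:F *: u + w).
    by apply/Zp_span_cons; exists c => //; rewrite addrAC subrr add0r.
  by rewrite opprD addrA.
- by case=> w; rewrite Zp_span_nil => ->; rewrite subr0.
- case=> w /Zp_span_cons[c _ sw] tvw; apply/Zp_span_cons; exists c => //.
  by apply: IHs; exists (w - c%:F *: u) => //; rewrite opprB addrA subrK.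
Qed.

Lemma scale_setE a L (v : V) : a != 0 -> scale_set a L v <-> L (a^-1 *: v).
Proof.
move=> a0; split=> [[w Lw <-]|Lv]; first by rewrite scalerA mulVf // scale1r.
by exists (a^-1 *: v) => //; rewrite scalerA mulfV // scale1r.
Qed.

Lemma scale_setM a b L : scale_set a (scale_set b L) = scale_set (a * b) L.
Proof.
apply/seteqP; split=> [_ [_ [v Lv <-] <-]|_ [v Lv <-]].
  by exists v => //; rewrite scalerA.
by exists (b *: v); [exists v | rewrite scalerA].
Qed.

Lemma scale_set1 L : scale_set 1 L = L.
Proof.
apply/seteqP; split=> [_ [v Lv <-]|v Lv]; first by rewrite scale1r.
by exists v => //; rewrite scale1r.
Qed.

Lemma scale_setS a L M : L `<=` M -> scale_set a L `<=` scale_set a M.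
Proof. by move=> LM _ [v Lv <-]; exists v => //; apply: LM. Qed.

Lemma Zp_span_scale a s :
  Zp_span [seq a *: v | v <- s] = scale_set a (Zp_span s).
Proof.
apply/seteqP; split=> v.
  case/Zp_span_nat=> c ->; rewrite size_map.
  exists (\sum_(0 <= i < size s) (c i)%:F *: s`_i).
    by apply/Zp_span_nat; exists c.
  rewrite scaler_sumr; apply: eq_big_nat => i /andP[_ i_lt].
  by rewrite (nth_map 0) // !scalerA mulrC.
case=> _ /Zp_span_nat[c ->] <-; apply/Zp_span_nat; exists c.
rewrite size_map scaler_sumr; apply: eq_big_nat => i /andP[_ i_lt].
by rewrite (nth_map 0) // !scalerA mulrC.
Qed.

Lemma lattice0 L : lattice L -> L 0.
Proof. by case=> -[s ->] _; apply: Zp_span0. Qed.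

Lemma latticeD L (v w : V) : lattice L -> L v -> L w -> L (v + w).
Proof. by case=> -[s ->] _; apply: Zp_spanD. Qed.

Lemma latticeZ L a (v : V) :
  lattice L -> a \in @integral p p_pr -> L v -> L (a *: v).
Proof. by case=> -[s ->] _; apply: Zp_spanZ. Qed.

Lemma lattice_scale a L : a != 0 -> lattice L -> lattice (scale_set a L).
Proof.
move=> a0 [[s ->] Lspan]; split.
  by exists [seq a *: v | v <- s]; rewrite Zp_span_scale.
move=> v; have [t tL vt] := Lspan v.
exists [seq a *: w | w <- t] => [_ /mapP[w wt ->]|].
  by exists w => //; apply: tL.
apply: subvP vt; apply/span_subvP => w wt.
rewrite -[w]scale1r -(mulVf a0) -scalerA memvZ //.
by apply: memv_span; apply: map_f.
Qed.

Lemma lattice_add L M : lattice L -> lattice M -> lattice (add_set L M).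
Proof.
move=> L_lat M_lat; split.
  have [[s ->] _] := L_lat; have [[t ->] _] := M_lat.
  by exists (s ++ t); rewrite Zp_span_cat.
move=> v; have [t tL vt] := L_lat.2 v; exists t => // w /tL Lw.
by exists w => //; rewrite subrr; apply: lattice0.
Qed.

Lemma homothetic_sym L M : homothetic L M -> homothetic M L.
Proof.
case=> a a0 ->; exists a^-1; first by rewrite invr_neq0.
by rewrite scale_setM mulVf // scale_set1.
Qed.

Lemma homothetic_trans L M N :
  homothetic L M -> homothetic M N -> homothetic L N.
Proof.
case=> a a0 -> [b b0 ->]; exists (b * a); first by rewrite mulf_neq0.
by rewrite scale_setM.
Qed.

Lemma homothety_classP L M : lattice L ->
  homothety_class L = homothety_class M <-> homothetic M L.
Proof.
move=> L_lat; split=> [LM|ML].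
  have : homothety_class L L.
    by split=> //; exists 1; [exact: oner_neq0 | rewrite scale_set1].
  by rewrite LM => -[].
apply/seteqP; split=> N [N_lat N_hom]; split=> //.
  exact: homothetic_trans N_hom.
exact: homothetic_trans (homothetic_sym ML) N_hom.
Qed.

Lemma homothety_class_scale a L :
  a != 0 -> lattice L -> homothety_class (scale_set a L) = homothety_class L.
Proof.
move=> a0 L_lat; apply/homothety_classP; first exact: lattice_scale.
by exists a.
Qed.

Lemma scale_p_sub L (n : nat) : lattice L -> scale_set (p%:R ^+ n) L `<=` L.
Proof.
move=> L_lat _ [v Lv <-]; apply: latticeZ => //.
by rewrite rpredX ?rpred_nat.
Qed.

(** Two lattices L and M with p L <= M <= L have equal or adjacent classes:
the classes are equal if one of the inclusions is an equality. *)
Lemma eq_or_skeleton1 L M : lattice L -> lattice M ->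
    M `<=` L -> scale_set p%:R L `<=` M ->
  homothety_class M = homothety_class L \/
  skeleton1 (homothety_class L) (homothety_class M).
Proof.
move=> L_lat M_lat ML LM.
have [LM'|LM'] := pselect (L `<=` M).
  by left; congr homothety_class; apply/seteqP.
have [ML'|ML'] := pselect (M `<=` scale_set p%:R L).
  left; have -> : M = scale_set p%:R L by apply/seteqP.
  exact/homothety_class_scale/L_lat/padic_p_neq0.
right; apply/asboolP; exists (fun i => if i is 0%N then L else M); split.
- by case.
- by case.
- by [].
- apply/seteqP; split=> [x [->|->]|_ [[|i] _ <-]].
  + by exists 0%N.
  + by exists 1%N.
  + by left.
  + by right.
Qed.

(** Adjacency is symmetric, so L may play the role of either lattice of the
chain that witnesses it. In the second role, L being a N_1, the neighbour is
represented by p a N_0. *)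
Lemma skeleton1_between L y : lattice L -> skeleton1 (homothety_class L) y ->
  exists M, [/\ lattice M, homothety_class M = y,
                M `<=` L & scale_set p%:R L `<=` M].
Proof.
have p0 := @padic_p_neq0 p p_pr.
move=> L_lat /asboolP[N [N_lat N10 [pN0 _] xyE]].
have {N10} [N10 _] := N10 0%N isT.
have N_lat0 : lattice (N 0%N) by apply: N_lat.
have N_lat1 : lattice (N 1%N) by apply: N_lat.
have [i i1 xE] : [set homothety_class (N i) | i in [set i | (i <= 1)%N]]
    (homothety_class L) by rewrite -xyE; left.
have [j j1 yE] : [set homothety_class (N i) | i in [set i | (i <= 1)%N]] y.
  by rewrite -xyE; right.
have [a a0 LE] : homothetic (N i) L.
  by apply/homothety_classP.
case: i i1 xE LE => [|[|//]] _ xE LE; case: j j1 yE => [|[|//]] _ yE.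
- exists L; split=> //; first by rewrite -xE -yE.
  by rewrite -[p%:R]expr1; apply: scale_p_sub.
- exists (scale_set a (N 1%N)); split.
  + exact: lattice_scale.
  + by rewrite homothety_class_scale.
  + by rewrite LE; apply: scale_setS.
  + by rewrite LE scale_setM mulrC -scale_setM; apply: scale_setS.
- exists (scale_set a (scale_set p%:R (N 0%N))); split.
  + by apply: lattice_scale => //; apply: lattice_scale.
  + by rewrite !homothety_class_scale //; apply: lattice_scale.
  + by rewrite LE; apply: scale_setS.
  + by rewrite LE scale_setM mulrC -scale_setM; do 2!apply: scale_setS.
- exists L; split=> //; first by rewrite -xE -yE.
  by rewrite -[p%:R]expr1; apply: scale_p_sub.
Qed.

(** The first step of the path goes from L to M + p L; it is omitted when the
two classes are equal. *)
Lemma path_of_sub n L M : lattice L -> lattice M ->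
    M `<=` L -> scale_set (p%:R ^+ n) L `<=` M ->
  exists s : seq (set (set V)),
    [/\ (size s <= n)%N, path (@skeleton1 p p_pr d) (homothety_class L) s
      & last (homothety_class L) s = homothety_class M].
Proof.
have p0 := @padic_p_neq0 p p_pr.
elim: n L => [|n IHn] L L_lat M_lat ML LM.
  exists [::]; split=> //=; congr homothety_class; apply/seteqP; split=> //.
  by move: LM; rewrite expr0 scale_set1.
pose N := add_set M (scale_set p%:R L).
have pL_lat : lattice (scale_set p%:R L) by apply: lattice_scale.
have N_lat : lattice N by apply: lattice_add.
have MN : M `<=` N.
  by move=> v Mv; exists v => //; rewrite subrr; apply: lattice0.
have NL : N `<=` L.
  move=> v [w Mw pLvw]; rewrite -(subrK w v); apply: latticeD => //.
    by apply: (@scale_p_sub _ 1) => //; rewrite expr1.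
  exact: ML.
have pLN : scale_set p%:R L `<=` N.
  by move=> v pLv; exists 0; rewrite ?subr0 //; apply: lattice0.
have NM : scale_set (p%:R ^+ n) N `<=` M.
  move=> _ [v [w Mw [u Lu vwE]] <-].
  rewrite -(subrK w v) -vwE scalerDr; apply: latticeD => //.
    by apply: LM; exists u => //; rewrite scalerA -exprSr.
  by apply: (@scale_p_sub _ n) => //; exists w.
have [s [s_size s_path s_last]] := IHn N N_lat M_lat MN NM.
have [NLE|L_N] := eq_or_skeleton1 L_lat N_lat NL pLN.
  by exists s; rewrite -NLE; split=> //; apply: leqW.
by exists (homothety_class N :: s); rewrite /= L_N; split.
Qed.

Lemma sub_of_path (s : seq (set (set V))) L : lattice L ->
    path (@skeleton1 p p_pr d) (homothety_class L) s ->
  exists M, [/\ lattice M, homothety_class M = last (homothety_class L) s,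
                M `<=` L & scale_set (p%:R ^+ size s) L `<=` M].
Proof.
elim: s L => [|y s IHs] L L_lat /=.
  by move=> _; exists L; split=> //; rewrite expr0 scale_set1.
case/andP=> /skeleton1_between-/(_ L_lat)[N [N_lat <- NL LN]] /IHs.
move=> /(_ N_lat)[M [M_lat ME MN NM]]; exists M; split=> //.
  exact: subset_trans NL.
apply: subset_trans NM; rewrite exprSr -scale_setM.
exact: scale_setS.
Qed.

(** The distance is the least n with p^n L <= a M <= L for some nonzero a. *)
Lemma graph_dist_skeleton1 L M (n : nat) : lattice L -> lattice M ->
    (forall (k : nat) a, a != 0 -> scale_set a M `<=` L ->
       scale_set (p%:R ^+ k) L `<=` scale_set a M -> (n <= k)%N) ->
    (exists a, [/\ a != 0, scale_set a M `<=` L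
                 & scale_set (p%:R ^+ n) L `<=` scale_set a M]) ->
  graph_dist (@skeleton1 p p_pr d) (homothety_class L) (homothety_class M)
  = n%:Z%:E.
Proof.
move=> L_lat M_lat n_min [a [a0 aML LaM]].
have aM_lat := lattice_scale a0 M_lat.
have [s [s_size s_path s_last]] := path_of_sub L_lat aM_lat aML LaM.
rewrite homothety_class_scale // in s_last.
rewrite /graph_dist; case: pselect => [ex|[]]; last first.
  by exists (size s); apply/asboolP; exists s.
case: ex_minnP => m /asboolP[t [<- t_path t_last]] m_min.
congr (_%:Z%:E); apply/eqP; rewrite eqn_leq; apply/andP; split.
  by apply: leq_trans s_size; apply: m_min; apply/asboolP; exists s.
have [N [N_lat NE NL LN]] := sub_of_path L_lat t_path.
have [b b0 bE] : homothetic M N by apply/homothety_classP; rewrite // NE.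
by apply: (n_min _ b) => //; rewrite -bE.
Qed.

End Lattices.

(** * Products and inverses of invertible matrices *)

Lemma basis_matrix_unit (K : fieldType) (d : nat) (F : d.-tuple 'rV[K]_d) :
  basis_of fullv F -> \matrix_(i < d) tnth F i \in unitmx.
Proof.
move=> F_basis; pose X := \matrix_(i < d, j < d) coord F j (delta_mx 0 i).
suff /mulmx1_unit[] : X *m \matrix_(i < d) tnth F i = 1%:M by [].
apply/row_matrixP => i; rewrite row_mul row1.
rewrite [RHS](coord_basis F_basis (memvf _)) mulmx_sum_row.
by apply: eq_bigr => j _; rewrite !mxE rowK (tnth_nth 0).
Qed.

Lemma det_unit_neq0 (K : fieldType) (d : nat) (M : 'M[K]_d) :
  M \in unitmx -> \det M != 0.
Proof. by rewrite unitmxE unitfE. Qed.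

Lemma mulmx_unit (K : fieldType) (d : nat) (M N : 'M[K]_d) :
  M \in unitmx -> N \in unitmx -> M *m N \in unitmx.
Proof. by rewrite unitmx_mul => -> ->. Qed.

Lemma mulmx_inv_unit (K : fieldType) (d : nat) (M N : 'M[K]_d) :
  M \in unitmx -> N \in unitmx -> M *m invmx N \in unitmx.
Proof. by rewrite unitmx_mul unitmx_inv => -> ->. Qed.

Lemma mulmx_cancelr (K : fieldType) (d : nat) (X Y M : 'M[K]_d) :
    Y \in unitmx -> M \in unitmx ->
  (X *m M) *m invmx (Y *m M) = X *m invmx Y.
Proof.
move=> YU MU; have YMU := mulmx_unit YU MU.
apply: (can_inj (mulmxK YMU)); rewrite mulmxKV //.
by rewrite [RHS]mulmxA mulmxKV.
Qed.

Lemma scale_mulmx_inv (K : fieldType) (d : nat) (M N : 'M[K]_d) (a b : K) :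
    M \in unitmx -> N \in unitmx ->
  (a *: (M *m invmx N)) *m (b *: (N *m invmx M)) = (a * b)%:M.
Proof.
move=> MU NU; rewrite -scalemxAl -scalemxAr scalerA mulmxA mulmxKV //.
by rewrite mulmxV // scalemx1.
Qed.

(** * Lattices spanned by the rows of a matrix *)

Section RowLattice.
Variables (p : nat) (p_pr : prime p) (d : nat).
Local Notation Z_p := (padic_int p_pr).
Local Notation Q_p := (padic p_pr).
Local Notation V := 'rV[Q_p]_d.
Local Notation integral := (@integral p p_pr).
Local Notation "x %:F" := (@FracField.tofrac Z_p x).
Local Open Scope classical_set_scope.
Implicit Types G H : 'M[Q_p]_d.

Lemma mxOver_integralM m n q (M : 'M[Q_p]_(m, n)) (N : 'M[Q_p]_(n, q)) :
    M \is a mxOver integral -> N \is a mxOver integral ->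
  M *m N \is a mxOver integral.
Proof. exact: mxOverM. Qed.

(** The lattice spanned by the rows of an invertible matrix G, described by the
integrality of the coordinates with respect to these rows. *)
Definition row_lattice G : set V :=
  [set v | v *m invmx G \is a mxOver integral].

Lemma Zp_span_rows G : G \in unitmx ->
  Zp_span [seq row i G | i <- enum 'I_d] = row_lattice G.
Proof.
move=> GU; apply/seteqP; split=> v.
  case/Zp_span_nat=> c; rewrite size_map size_enum_ord big_mkord => ->.
  have -> : \sum_(i < d) (c i)%:F *: [seq row i G | i <- enum 'I_d]`_i =
            (\row_i (c i)%:F) *m G.
    rewrite mulmx_sum_row; apply: eq_bigr => i _; rewrite mxE.
    by rewrite (nth_map i) ?size_enum_ord // nth_ord_enum.
  rewrite /row_lattice /= mulmxK //; apply/mxOverP => i j; rewrite mxE.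
  exact: integral_tofrac.
move=> /mxOverP vG.
have /choice[c cE] : forall i, exists x : Z_p, (v *m invmx G) 0 i = x%:F.
  by move=> i; apply/integralP/vG.
apply/Zp_span_nat; exists (fun k => if insub k is Some i then c i else 0).
rewrite size_map size_enum_ord big_mkord -[LHS](mulmxKV GU) mulmx_sum_row.
apply: eq_bigr => i _.
by rewrite valK (nth_map i) ?size_enum_ord // nth_ord_enum cE.
Qed.

Lemma row_in_lattice G i : G \in unitmx -> row_lattice G (row i G).
Proof.
move=> GU; rewrite /row_lattice /= -row_mul mulmxV // row1.
by apply/mxOverP => k j; rewrite mxE rpred_nat.
Qed.

Lemma lattice_row_lattice G : G \in unitmx -> lattice (row_lattice G).
Proof.
move=> GU; split; first by eexists; rewrite -Zp_span_rows.
move=> v; exists [seq row i G | i <- enum 'I_d].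
  by move=> _ /mapP[i _ ->]; apply: row_in_lattice.
rewrite -[v](mulmxKV GU) mulmx_sum_row; apply: memv_suml => i _.
by apply: memvZ; apply: memv_span; apply: map_f; rewrite mem_enum.
Qed.

Lemma represented_vertexE (F : d.-tuple V) (A : 'M[Q_p]_d) :
    basis_of fullv F -> A \in unitmx ->
  represented_vertex F A =
  homothety_class (row_lattice (A *m \matrix_(i < d) tnth F i)).
Proof.
move=> F_basis AU; rewrite -Zp_span_rows; last first.
  exact/mulmx_unit/basis_matrix_unit.
congr (homothety_class (Zp_span _)); apply: eq_map => i.
by rewrite row_mul mulmx_sum_row; apply: eq_bigr => j _; rewrite rowK mxE.
Qed.

Lemma row_lattice_sub a b G H : a != 0 -> b != 0 -> G \in unitmx ->
    H \in unitmx ->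
  scale_set a (row_lattice G) `<=` scale_set b (row_lattice H) <->
  (a / b) *: (G *m invmx H) \is a mxOver integral.
Proof.
move=> a0 b0 GU HU; split=> [GH|/mxOverP GH _ [v /= vG <-]].
  apply/mxOverP => i j.
  have /scale_setE-/(_ b0) : scale_set b (row_lattice H) (a *: row i G).
    by apply: GH; exists (row i G) => //; apply: row_in_lattice.
  rewrite /row_lattice /= scalerA -scalemxAl => /mxOverP/(_ 0 j).
  by rewrite -row_mul !mxE [a / b]mulrC.
apply/(scale_setE _ _ b0); rewrite /row_lattice /= scalerA.
have -> : (b^-1 * a *: v) *m invmx H =
          (v *m invmx G) *m ((a / b) *: (G *m invmx H)).
  by rewrite -scalemxAr mulmxA (mulmxKV GU) -scalemxAl [a / b]mulrC.
by apply: mxOver_integralM => //; apply/mxOverP.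
Qed.

Lemma row_lattice_sub1 a G H : a != 0 -> G \in unitmx -> H \in unitmx ->
  scale_set a (row_lattice G) `<=` row_lattice H <->
  a *: (G *m invmx H) \is a mxOver integral.
Proof.
move=> a0 GU HU; have := row_lattice_sub a0 (oner_neq0 _) GU HU.
by rewrite scale_set1 divr1.
Qed.

Lemma exists_min_val_entry (M : 'M[Q_p]_d) : M != 0 ->
  exists2 m : int, (forall i j, (m%:E <= val_p (M i j))%E)
                 & exists i j, val_p (M i j) = m%:E.
Proof.
move=> M0.
have [i0 [j0 M_neq0]] : exists i j, M i j != 0.
  apply: contrapT => M_eq0; case/eqP: M0; apply/matrixP => i j; rewrite mxE.
  by apply: contrapT => /eqP Mij; apply: M_eq0; exists i, j.
case: (@arg_minP _ _ _ (i0, j0) predT (fun k => val_p (M k.1 k.2)) isT).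
move=> [i j] _ /= ij_min.
have Mij0 : M i j != 0.
  apply: contraNneq M_neq0 => Mij; have := ij_min (i0, j0) isT.
  rewrite Mij val_p0 leye_eq /=.
  by apply: contraLR => /val_p_fin[k ->].
have [m mE] := val_p_fin Mij0; exists m; last by exists i, j.
by move=> k l; rewrite -mE; apply: (ij_min (k, l)).
Qed.

(** If m is the least valuation of the entries of M and k is the valuation of a,
then a M is integral exactly when k + m >= 0. *)
Lemma scale_integral_mx (M : 'M[Q_p]_d) (m k : int) a :
    (forall i j, (m%:E <= val_p (M i j))%E) ->
    (exists i j, val_p (M i j) = m%:E) -> val_p a = k%:E ->
  (a *: M \is a mxOver integral) = (0 <= k + m).
Proof.
move=> m_le [i [j mE]] ak; apply/mxOverP/idP => [/(_ i j)|km k' l].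
  by rewrite mxE -val_p_ge0 val_pM ak mE -EFinD lee_fin.
rewrite mxE -val_p_ge0 val_pM ak.
apply: (@le_trans _ _ (k + m)%:E); first by rewrite lee_fin.
by rewrite EFinD leeD2l.
Qed.

End RowLattice.

(** * The distance formula *)

Lemma absz_sum_le (m m' e : int) (k : nat) :
  0 <= - m - m' -> 0 <= e + m' -> 0 <= k%:Z - e + m -> (`|- m - m'| <= k)%N.
Proof. lia. Qed.

Theorem theorem1 (p : nat) (p_pr : prime p) (d : nat) (d_ge2 : (2 <= d)%N)
    (F : d.-tuple 'rV[padic p_pr]_d) (A B : 'M[padic p_pr]_d)
    (F_basis : basis_of fullv F) (A_unit : A \in unitmx) (B_unit : B \in unitmx) :
  graph_dist (@skeleton1 p p_pr d) (represented_vertex F A) (represented_vertex F B) =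
  (min_val A 0 B d + min_val A d B 0 - min_val A 1 B d.-1 - min_val A d.-1 B 1)%E.
Proof.
have d_gt0 : (0 < d)%N by apply: leq_trans d_ge2.
have unit_neq0 (M : 'M[padic p_pr]_d) : M \in unitmx -> M != 0.
  move=> MU; apply/eqP => M0; have := mulmxV MU; rewrite M0 mul0mx.
  move/matrixP/(_ (Ordinal d_gt0) (Ordinal d_gt0)) => /eqP.
  by rewrite !mxE eqxx eq_sym oner_eq0.
have p0 := @padic_p_neq0 p p_pr.
have CU := mulmx_inv_unit A_unit B_unit.
have CU' := mulmx_inv_unit B_unit A_unit.
have [m m_le mE] := exists_min_val_entry (unit_neq0 _ CU).
have [m' m'_le m'E] := exists_min_val_entry (unit_neq0 _ CU').
have [a aE] := val_p_fin (det_unit_neq0 A_unit).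
have [b bE] := val_p_fin (det_unit_neq0 B_unit).
rewrite min_val0 [min_val A d B 0]min_valC min_val0.
rewrite (min_val1 B_unit m_le mE) [min_val A d.-1 B 1]min_valC.
rewrite (min_val1 A_unit m'_le m'E) aE bE.
(* Both p^(-m) A B^-1 and p^(-m') B A^-1 are integral; their product is the
   scalar matrix of p^(-m-m'). *)
have mm'_le0 : 0 <= - m - m'.
  have CI := scale_integral_mx m_le mE (val_p_expz p_pr (- m)).
  have CI' := scale_integral_mx m'_le m'E (val_p_expz p_pr (- m')).
  rewrite !addNr lexx in CI CI'.
  have := mxOver_integralM CI CI'; rewrite (scale_mulmx_inv _ _ A_unit B_unit).
  move/mxOverP/(_ (Ordinal d_gt0) (Ordinal d_gt0)).
  by rewrite mxE eqxx mulr1n -val_p_ge0 val_pM !val_p_expz -EFinD lee_fin.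
have -> : (b%:E + a%:E - (b%:E + m%:E) - (a%:E + m'%:E))%E =
          (`|- m - m'|%N%:Z)%:E.
  rewrite (gez0_abs mm'_le0) -!EFinN -!EFinD; congr (_%:E).
  by rewrite opprD addrA [b + a]addrC addrK opprD addrACA addrN add0r.
rewrite !represented_vertexE //.
have FU := basis_matrix_unit F_basis.
have AFU := mulmx_unit A_unit FU; have BFU := mulmx_unit B_unit FU.
have CE := mulmx_cancelr A B_unit FU; have CE' := mulmx_cancelr B A_unit FU.
apply: (graph_dist_skeleton1 (lattice_row_lattice AFU)
                             (lattice_row_lattice BFU)).
  move=> k c c0; have [e eE] := val_p_fin c0.
  move/(row_lattice_sub1 c0 BFU AFU); rewrite CE'.
  rewrite (scale_integral_mx m'_le m'E eE) => ge_e.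
  move/(row_lattice_sub (expf_neq0 _ p0) c0 AFU BFU); rewrite CE.
  have kE : val_p (p%:R ^+ k / c) = (k%:Z - e)%:E.
    by rewrite val_pM (val_pV c0) val_p_pexp eE.
  by rewrite (scale_integral_mx m_le mE kE) => /(absz_sum_le mm'_le0 ge_e).
(* Among the multiples of the lattice of B, the one by p^(-m') is the largest
   that the lattice of A contains. *)
pose c : padic p_pr := p%:R ^ (- m').
have c0 : c != 0 := expfz_neq0 _ p0.
exists c; split; first exact: c0.
  apply/(row_lattice_sub1 c0 BFU AFU); rewrite CE'.
  by rewrite (scale_integral_mx m'_le m'E (val_p_expz _ _)) addNr.
apply/(row_lattice_sub (expf_neq0 _ p0) c0 AFU BFU); rewrite CE.
have nE : val_p (p%:R ^+ `|- m - m'|%N / c) = (- m)%:E.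
  rewrite val_pM (val_pV c0) val_p_pexp val_p_expz (gez0_abs mm'_le0).
  by rewrite -EFinN -EFinD opprK subrK.
by rewrite (scale_integral_mx m_le mE nE) addNr.
Qed.
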